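(* Let $\mathbb{K}$ be a field of characteristic zero and let $n \geqslant 2$. The Lie algebra $\mathrm{Vec}^c(\mathbb{A}^n)$ is $1.5$-generated; that is, for every nonzero $\delta\in \mathrm{Vec}^c(\mathbb{A}^n)$ there exists $D\in \mathrm{Vec}^c(\mathbb{A}^n)$ such that $\delta$ and $D$ generate the Lie algebra $\mathrm{Vec}^c(\mathbb{A}^n)$.
   Context: $\mathbb{A}^n$ is the $n$-dimensional affine space over $\mathbb{K}$ with coordinates $x_1,\ldots,x_n$. $\mathrm{Vec}(\mathbb{A}^n)$ is the Lie algebra of polynomial vector fields $f_1\partial_{x_1}+\ldots+f_n\partial_{x_n}$ with $f_1,\ldots,f_n\in\mathbb{K}[x_1,\ldots,x_n]$ (equivalently, all $\mathbb{K}$-derivations of $\mathbb{K}[x_1,\ldots,x_n]$), where $\partial_{x_i}$ is the partial derivative with respect to $x_i$, and the bracket is the commutator, i.e. $[f\partial_{x_i}, g\partial_{x_j}] = f\frac{\partial g}{\partial x_i}\partial_{x_j} - g\frac{\partial f}{\partial x_j}\partial_{x_i}$. The divergence is $\operatorname{div}(f_1\partial_{x_1}+\ldots+f_n\partial_{x_n}) = \frac{\partial f_1}{\partial x_1}+\ldots+\frac{\partial f_n}{\partial x_n}$. $\mathrm{Vec}^c(\mathbb{A}^n) = \{\delta\in \mathrm{Vec}(\mathbb{A}^n) \mid \operatorname{div}(\delta)\in\mathbb{K}\}$ is the Lie subalgebra of vector fields with constant divergence. A subset $S$ generates a Lie algebra $\mathcal{L}$ if the smallest Lie subalgebra of $\mathcal{L}$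 containing $S$ is $\mathcal{L}$. A Lie algebra $\mathcal{L}$ is $1.5$-generated if for every nonzero $x\in\mathcal{L}$ there exists $y\in\mathcal{L}$ such that $x$ and $y$ generate $\mathcal{L}$. *)

(* Defs.v *)
From HB Require Import structures.
From mathcomp Require Import all_boot all_order all_algebra.
From mathcomp Require Import mpoly ring.

Set Implicit Arguments.
Unset Strict Implicit.
Unset Printing Implicit Defensive.

Import GRing.Theory.
Local Open Scope ring_scope.

HB.mixin Record isLieAlgebra (K : fieldType) L of GRing.Lmodule K L := {
  lie : L -> L -> L;
  lie_linearl : forall y : L, linear (lie^~ y);
  lie_linearr : forall x : L, linear (lie x);
  lie_alternating : forall x : L, lie x x = 0;
  lie_jacobi : forall x y z : L,
    lie x (lie y z) + lie y (lie z x) + lie z (lie x y) = 0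
}.

#[short(type="lieAlgType")]
HB.structure Definition LieAlgebra (K : fieldType) :=
  {L of isLieAlgebra K L & GRing.Lmodule K L}.

Section Generation.
Variables (K : fieldType) (L : lieAlgType K).

Definition lie_subalgebra (A : L -> Prop) : Prop :=
  [/\ A 0,
      forall (a : K) (x y : L), A x -> A y -> A (a *: x + y)
    & forall x y : L, A x -> A y -> A (lie x y)].

(* The intersection of all Lie subalgebras containing S. *)
Definition lie_span (S : L -> Prop) (x : L) : Prop :=
  forall A : L -> Prop,
    lie_subalgebra A -> (forall s, S s -> A s) -> A x.

Lemma lie_span_subalgebra (S : L -> Prop) : lie_subalgebra (lie_span S).
Proof.
split=> [A [] //|a x y Sx Sy A subA SA|x y Sx Sy A subA SA].
  by have [_ + _] := subA; apply; [exact: Sx | exact: Sy].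
by have [_ _] := subA; apply; [exact: Sx | exact: Sy].
Qed.

Lemma sub_lie_span (S : L -> Prop) x : S x -> lie_span S x.
Proof. by move=> Sx A _; apply. Qed.

Definition generates (S : L -> Prop) : Prop := forall x : L, lie_span S x.

Definition one_and_a_half_generated : Prop :=
  forall x : L, x != 0 -> exists y : L, generates (fun s => s = x \/ s = y).

End Generation.

Arguments one_and_a_half_generated {K} L.

Section VectorFields.
Variables (K : fieldType) (n : nat).

(* v stands for v 0 d/dx_0 + ... + v (n-1) d/dx_(n-1). *)
Definition Vec : Type := {ffun 'I_n -> {mpoly K[n]}}.
HB.instance Definition _ := 
  GRing.Lmodule.copy Vec {ffun 'I_n -> {mpoly K[n]}}.

Definition vapply (v : Vec) (p : {mpoly K[n]}) : {mpoly K[n]} :=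
  \sum_(i < n) v i * mderiv i p.

(* Commutator of derivations, in coordinates: its value on the j-th variable is
   v(w_j) - w(v_j); see vapply_bracket and vbracket_vfield. *)
Definition vbracket (v w : Vec) : Vec :=
  [ffun j => vapply v (w j) - vapply w (v j)].

Definition divergence (v : Vec) : {mpoly K[n]} := \sum_(i < n) mderiv i (v i).

Lemma vapply_is_linear v : linear (vapply v).
Proof.
move=> a p q; rewrite /vapply scaler_sumr -big_split; apply: eq_bigr => i _ /=.
by rewrite mderivD mderivZ mulrDr scalerAr.
Qed.
HB.instance Definition _ v :=
  GRing.isLinear.Build K {mpoly K[n]} {mpoly K[n]} _ (vapply v)
    (vapply_is_linear v).

Lemma vapply_linearl p : linear (vapply^~ p).
Proof.
move=> a v w; rewrite /vapply scaler_sumr -big_split; apply: eq_bigr => i _ /=.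
by rewrite !ffunE mulrDl scalerAl.
Qed.

Lemma vapplyM v p q : vapply v (p * q) = vapply v p * q + p * vapply v q.
Proof.
rewrite /vapply mulr_suml mulr_sumr -big_split; apply: eq_bigr => i _ /=.
by rewrite mderivM mulrDr !mulrA [v i * p]mulrC.
Qed.

Lemma vapplyC v c : vapply v c%:MP = 0.
Proof. by rewrite /vapply big1 // => i _; rewrite mderivC mulr0. Qed.

Lemma vapply_bracket v w p :
  vapply (vbracket v w) p = vapply v (vapply w p) - vapply w (vapply v p).
Proof.
have E v' w' : vapply v' (vapply w' p) =
    \sum_(j < n) vapply v' (w' j) * mderiv j p +
    \sum_(i < n) \sum_(j < n) v' i * w' j * mderiv i (mderiv j p).
  rewrite [vapply w' p]/vapply linear_sum [X in _ + X]exchange_big -big_split /=.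
  apply: eq_bigr => j _. rewrite vapplyM; congr (_ + _).
  by rewrite {1}/vapply mulr_sumr; apply: eq_bigr => i _; rewrite mulrA [w' j * _]mulrC.
rewrite !E opprD addrACA.
rewrite [X in _ + (_ - X)]exchange_big /=.
rewrite (_ : \sum_(j < n) \sum_(i < n) w i * v j * mderiv i (mderiv j p) =
   \sum_(i < n) \sum_(j < n) v i * w j * mderiv i (mderiv j p)); last first.
  by apply: eq_bigr => i _; apply: eq_bigr => j _; rewrite mderiv_comm [w j * _]mulrC.
rewrite subrr addr0 -sumrB; apply: eq_bigr => i _.
by rewrite ffunE mulrBl.
Qed.

(* f d/dx_i *)
Definition vfield (i : 'I_n) (f : {mpoly K[n]}) : Vec :=
  [ffun k => if k == i then f else 0].

Lemma vec_sumE (v : Vec) : v = \sum_(i < n) vfield i (v i).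
Proof.
apply/ffunP => k; rewrite sum_ffunE (bigD1 k) //= big1 ?addr0 => [|i /negPf ik].
  by rewrite ffunE eqxx.
by rewrite ffunE eq_sym ik.
Qed.

Lemma vbracket_vfield i j f g :
  vbracket (vfield i f) (vfield j g) =
  vfield j (f * mderiv i g) - vfield i (g * mderiv j f).
Proof.
have E k p h : vapply (vfield k h) p = h * mderiv k p.
  rewrite /vapply (bigD1 k) //= big1 ?addr0 => [|l /negPf lk].
    by rewrite ffunE eqxx.
  by rewrite ffunE lk mul0r.
apply/ffunP => k; rewrite !ffunE !E.
by congr (_ - _); case: ifP => // _; rewrite mderiv0 mulr0.
Qed.

Lemma vbracket_linearl w : linear (vbracket^~ w).
Proof.
move=> a u v; apply/ffunP => j; rewrite !ffunE vapply_linearl linearP /=.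
by rewrite scalerBr opprD addrACA.
Qed.

Lemma vbracket_linearr v : linear (vbracket v).
Proof.
move=> a u w; apply/ffunP => j; rewrite !ffunE vapply_linearl linearP /=.
by rewrite scalerBr opprD addrACA.
Qed.

Lemma vbracketvv v : vbracket v v = 0.
Proof. by apply/ffunP => j; rewrite !ffunE subrr. Qed.

Lemma vbracket_jacobi u v w :
  vbracket u (vbracket v w) + vbracket v (vbracket w u)
    + vbracket w (vbracket u v) = 0.
Proof.
apply/ffunP => j.
by rewrite !ffunE !vapply_bracket !raddfB /=; ring.
Qed.

HB.instance Definition _ := isLieAlgebra.Build K Vec
  vbracket_linearl vbracket_linearr vbracketvv vbracket_jacobi.

Lemma divergence_is_linear : linear divergence.
Proof.
move=> a v w; rewrite /divergence scaler_sumr -big_split; apply: eq_bigr => i _ /=.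
by rewrite !ffunE mderivD mderivZ.
Qed.
HB.instance Definition _ :=
  GRing.isLinear.Build K Vec {mpoly K[n]} _ divergence divergence_is_linear.

Lemma divergence_bracket v w :
  divergence (vbracket v w) =
  vapply v (divergence w) - vapply w (divergence v).
Proof.
have E (v' w' : Vec) : \sum_(j < n) mderiv j (vapply v' (w' j)) =
    \sum_(j < n) \sum_(i < n) mderiv j (v' i) * mderiv i (w' j) +
    vapply v' (divergence w').
  rewrite linear_sum -big_split; apply: eq_bigr => j _ /=.
  rewrite /vapply linear_sum -big_split; apply: eq_bigr => i _ /=.
  by rewrite mderivM mderiv_comm.
rewrite {1}/divergence.
under eq_bigr do rewrite ffunE mderivB.
rewrite sumrB !E opprD addrACA [X in X - _]exchange_big /=.
rewrite -[RHS]add0r; congr (_ + _); apply/eqP; rewrite subr_eq0; apply/eqP.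
by apply: eq_bigr => i _; apply: eq_bigr => j _; rewrite mulrC.
Qed.

(* The divergence equals its own constant term, i.e. it lies in K; boolean so
   that VecC is a subType (see const_divP). *)
Definition const_div : {pred Vec} :=
  fun v => divergence v == (mcoeff 0%MM (divergence v))%:MP.

Lemma const_divP (v : Vec) :
  reflect (exists c : K, divergence v = c%:MP) (v \in const_div).
Proof.
apply: (iffP eqP) => [->|[c ->]]; last by rewrite mcoeffC eqxx mulr1.
by exists (mcoeff 0%MM (divergence v)).
Qed.

Lemma const_div_submod_closed : submod_closed const_div.
Proof.
split=> [|a v w /const_divP[c Ev] /const_divP[d Ew]]; apply/const_divP.
  by exists 0; rewrite linear0 mpolyC0.
by exists (a * c + d); rewrite divergence_is_linear Ev Ew mpolyCD mpolyCM mul_mpolyC.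
Qed.
HB.instance Definition _ :=
  GRing.isSubmodClosed.Build K Vec const_div const_div_submod_closed.

Lemma const_div_bracket v w :
  v \in const_div -> w \in const_div -> vbracket v w \in const_div.
Proof.
move=> /const_divP[c Ev] /const_divP[d Ew]; apply/const_divP; exists 0.
by rewrite divergence_bracket Ev Ew !vapplyC subrr mpolyC0.
Qed.

Record VecC := MkVecC { vecC_val :> Vec; vecC_const : vecC_val \in const_div }.

HB.instance Definition _ := [isSub for vecC_val].
HB.instance Definition _ := [Choice of VecC by <:].
HB.instance Definition _ := [SubChoice_isSubLmodule of VecC by <:].

Definition vbracketC (v w : VecC) : VecC :=
  MkVecC (const_div_bracket (vecC_const v) (vecC_const w)).

Lemma vbracketC_linearl w : linear (vbracketC^~ w).
Proof. by move=> a u v; apply: val_inj; apply: vbracket_linearl. Qed.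

Lemma vbracketC_linearr v : linear (vbracketC v).
Proof. by move=> a u w; apply: val_inj; apply: vbracket_linearr. Qed.

Lemma vbracketCvv v : vbracketC v v = 0.
Proof. by apply: val_inj; apply: vbracketvv. Qed.

Lemma vbracketC_jacobi u v w :
  vbracketC u (vbracketC v w) + vbracketC v (vbracketC w u)
    + vbracketC w (vbracketC u v) = 0.
Proof. by apply: val_inj; apply: vbracket_jacobi. Qed.

HB.instance Definition _ := isLieAlgebra.Build K VecC
  vbracketC_linearl vbracketC_linearr vbracketCvv vbracketC_jacobi.

End VectorFields.

(* Main.v *)
Require Import Defs.
From HB Require Import structures.
From mathcomp Require Import all_boot all_order all_algebra.
From mathcomp Require Import mpoly ring zify.

(** The second generator is a generic diagonal field
    [D = \sum_i t^i x_i d/dx_i], pulled back by an automorphism that puts the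
    given field [delta] in general position.

    Suppose first that [delta] contains, for all [a != b], the monomial fields
    [d/dx_b] and [x_a^2 d/dx_b] with nonzero coefficients.  Monomial fields are
    eigenvectors of [ad D], and when [t] avoids finitely many values the
    eigenvalues separate the weights occurring in [delta].  The weight of a
    field [x^m d/dx_b] with [m_b = 0] has a [-1] at position [b], which
    determines the field, so [ad D] cuts all the [d/dx_b] and [x_a^2 d/dx_b]
    out of [delta] ([monomial_in_subalgebra]).  These generate all fields of
    divergence zero ([divergence_free_in]): three brackets turn [f d/dx_j] into
    a nonzero multiple of [x_i f d/dx_j] when [f] is a monomial without [x_j]
    ([raise_shear]), one more bracket yields the fields in two directions
    [x_i, x_j] with arbitrary monomial [x_i]-component
    ([divergence_free_completion]), and sums of those exhaust the
    divergence-free fields.  Finally [D] supplies a nonzero constant divergence.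

    An arbitrary nonzero [delta] is moved to general position by automorphisms
    [exp (c ad u)], where [u] runs over the fields [f d/dx_j] with [f]
    independent of [x_j], which are locally ad-nilpotent
    ([shear_ad_nilpotent]).  If a linear form does not vanish on
    [ad u_1 (... (ad u_r delta))], then the letters of this word can be absorbed
    one at a time, starting with [u_r]: the value of the form at
    [ad u_1 (... (ad u_(r-1) (exp (c ad u_r) delta)))] is a polynomial in [c]
    whose coefficient of [c] is the given nonzero value.  A generic [c] keeps
    this and all the conditions reached before nonzero ([generic_reduction]).
    It remains to find, for each required coefficient, a word detecting it
    ([shear_word_vcoef]): brackets with the [d/dx_i] reduce [delta] to a nonzero
    constant field, a bracket with [x_i d/dx_a] makes its [a]-component nonzero,
    and a bracket with [x_a^(d+1) d/dx_b] ends at [x_a^d d/dx_b]. *)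

Set Implicit Arguments.
Unset Strict Implicit.
Unset Printing Implicit Defensive.

Import GRing.Theory.
Local Open Scope ring_scope.

(** * Characteristic zero and double sums *)

Lemma natr_inj (R : idomainType) :
  [pchar R] =i pred0 -> injective (fun k => k%:R : R).
Proof.
move=> /pcharf0P char0 a b; wlog le_ab : a b / (a <= b)%N.
  by move=> W; case: (leqP a b) => [/W//|/ltnW /W ba /esym/ba].
move/esym/eqP; rewrite -subr_eq0 -natrB // char0; lia.
Qed.

Lemma natr_neq0 (R : idomainType) (k : nat) :
  [pchar R] =i pred0 -> (0 < k)%N -> k%:R != 0 :> R.
Proof. by move=> /pcharf0P ->; rewrite lt0n. Qed.

Lemma exists_common_nonroot (K : fieldType) (s : seq {poly K}) :
  [pchar K] =i pred0 -> all (fun p => p != 0) s ->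
  exists c : K, all (fun p : {poly K} => p.[c] != 0) s.
Proof.
move=> char0 nz_s.
pose q := \prod_(p <- s) p; pose r := [seq k%:R | k <- iota 0 (size q)] : seq K.
have nz_q : q != 0 by rewrite prodf_seq_neq0.
have uniq_r : uniq r by rewrite map_inj_uniq ?iota_uniq //; apply: natr_inj.
have /allPn[c _ qc] : ~~ all (root q) r.
  apply/negP=> /(max_poly_roots nz_q)/(_ uniq_r).
  by rewrite size_map size_iota ltnn.
exists c; apply/allP => p sp; apply: contra qc => /eqP pc0.
by rewrite /root horner_prod prodf_seq_eq0; apply/hasP; exists p; rewrite //= pc0.
Qed.

(** Summing a finitely supported double family along antidiagonals: the Cauchy
    product behind both the multiplicativity and the invertibility of
    exponentials. *)
Lemma sum_antidiagonals (V : nmodType) (g : nat -> nat -> V) N :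
  (forall i j, (N <= i)%N || (N <= j)%N -> g i j = 0) ->
  \sum_(k < N + N) \sum_(i < k.+1) g i (k - i)%N =
  \sum_(i < N) \sum_(j < N) g i j.
Proof.
move=> g0.
have -> : \sum_(k < N + N) \sum_(i < k.+1) g i (k - i)%N =
    \sum_(k < N + N) \sum_(i < N + N | (i <= k)%N) g i (k - i)%N.
  apply: eq_bigr => k _.
  by rewrite (big_ord_widen_cond (N + N) predT (fun i => g i (k - i)%N)).
rewrite (exchange_big_dep predT) //= big_split_ord /= [X in _ + X]big1 => [|i _].
  rewrite addr0; apply: eq_bigr => i _.
  rewrite -(big_mkord (fun k => i <= k)%N (fun k => g i (k - i)%N)).
  rewrite (@big_cat_nat _ _ _ i) ?leq_addr //=; last by case: i => i /=; lia.
  rewrite big_nat_cond big1 ?add0r => [|k]; last by lia.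
  rewrite -{1}[X in \sum_(X <= _ < _ | _) _]add0n big_addn.
  rewrite (@big_cat_nat _ _ _ N) //=; last by case: i => i /=; lia.
  rewrite [X in _ + X]big_nat_cond [X in _ + X]big1 ?addr0 => [|k]; last first.
    by move=> /andP[/andP[Nk _] _]; rewrite addnK g0 // Nk orbT.
  by rewrite big_mkord; apply: eq_big => j; rewrite ?leq_addl ?addnK.
rewrite big1 // => k /= _; apply: g0; lia.
Qed.

(** * Exponentials of locally nilpotent inner derivations *)

Section LieAlgebras.
Variables (K : fieldType) (L : lieAlgType K).
Implicit Types (x y u v : L) (c : K).

HB.instance Definition _ u := GRing.isLinear.Build K L L _ (lie u) (lie_linearr u).

Definition ad_word (s : seq L) x : L := foldr (@lie K L) x s.

Lemma ad_word_linear s : linear (ad_word s).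
Proof. by elim: s => [//|u s IH] a x y; rewrite /= IH linearP. Qed.
HB.instance Definition _ s :=
  GRing.isLinear.Build K L L _ (ad_word s) (ad_word_linear s).

Lemma lieDl x y v : lie (x + y) v = lie x v + lie y v.
Proof. by have := lie_linearl v 1 x y; rewrite !scale1r. Qed.

Lemma lie0l v : lie 0 v = 0.
Proof. by apply: (addrI (lie 0 v)); rewrite -lieDl !addr0. Qed.

Lemma lieZl c x v : lie (c *: x) v = c *: lie x v.
Proof. by have := lie_linearl v c x 0; rewrite lie0l !addr0. Qed.

Lemma lie_suml I (r : seq I) (P : pred I) (F : I -> L) v :
  lie (\sum_(i <- r | P i) F i) v = \sum_(i <- r | P i) lie (F i) v.
Proof. by apply: (big_morph (lie^~ v) (fun x y => lieDl x y v) (lie0l v)). Qed.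

Lemma lieC x y : lie y x = - lie x y.
Proof.
apply/eqP; rewrite -addr_eq0 addrC; apply/eqP.
have := lie_alternating (x + y).
by rewrite lieDl !linearD /= !lie_alternating add0r addr0.
Qed.

Lemma lie_leibniz u x y : lie u (lie x y) = lie (lie u x) y + lie x (lie u y).
Proof.
have /eqP := lie_jacobi u x y.
rewrite -addrA addr_eq0 opprD => /eqP ->.
by rewrite [lie y (lie u x)]lieC opprK [lie y u]lieC linearN /= opprK addrC.
Qed.

Section Exponential.
Hypothesis char0 : [pchar K] =i pred0.
Variable u : L.
Hypothesis nilp : forall x, exists N, iter N (lie u) x == 0.

Lemma iter_ad_linear k a x y : iter k (lie u) (a *: x + y) =
  a *: iter k (lie u) x + iter k (lie u) y.
Proof. by elim: k => //= k ->; rewrite linearP. Qed.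

Lemma iter_ad0 k : iter k (lie u) 0 = 0.
Proof. by elim: k => //= k ->; rewrite linear0. Qed.

Lemma iter_ad_eq0 k N x : iter N (lie u) x = 0 -> (N <= k)%N -> iter k (lie u) x = 0.
Proof. by move=> x0 /subnK <-; rewrite iterD x0 iter_ad0. Qed.

(** The sum stops at a nilpotency index of [x]; [exp_adE] says that any index
    does. *)
Definition exp_ad c x : L :=
  \sum_(k < xchoose (nilp x)) (c ^+ k / k`!%:R) *: iter k (lie u) x.

Lemma exp_adE N c x : iter N (lie u) x = 0 ->
  exp_ad c x = \sum_(k < N) (c ^+ k / k`!%:R) *: iter k (lie u) x.
Proof.
rewrite /exp_ad; move: (xchoose _) (eqP (xchooseP (nilp x))) => M.
wlog le_MN : M N / (M <= N)%N => [W M0 N0|M0 N0].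
  by case: (leqP M N) => [/W|/ltnW/W] h; [|symmetry]; apply: h.
rewrite -(subnKC le_MN) big_split_ord /= [X in _ + X]big1 ?addr0 // => k _.
by rewrite (iter_ad_eq0 M0) ?scaler0 // leq_addr.
Qed.

Lemma common_nilpotency x y : exists N, iter N (lie u) x = 0 /\ iter N (lie u) y = 0.
Proof.
have [[M /eqP x0] [N /eqP y0]] := (nilp x, nilp y); exists (M + N)%N.
by rewrite (iter_ad_eq0 x0) ?(iter_ad_eq0 y0) ?leq_addl ?leq_addr.
Qed.

Lemma exp_ad_linear c : linear (exp_ad c).
Proof.
move=> a x y; have [N [x0 y0]] := common_nilpotency x y.
rewrite !(@exp_adE N) // ?iter_ad_linear ?x0 ?y0 ?scaler0 ?addr0 //.
rewrite scaler_sumr -big_split; apply: eq_bigr => k _ /=.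
by rewrite iter_ad_linear scalerDr !scalerA mulrC.
Qed.
HB.instance Definition _ c :=
  GRing.isLinear.Build K L L _ (exp_ad c) (exp_ad_linear c).

Lemma bin_over_fact k i : (i <= k)%N ->
  'C(k, i)%:R / k`!%:R = (i`!%:R * (k - i)`!%:R)^-1 :> K.
Proof.
move=> ik; rewrite -(bin_fact ik) !natrM.
rewrite [in LHS]invfM mulrA divff ?mul1r // (natr_neq0 char0) // bin_gt0 //.
Qed.

(** Exponentials of derivations are automorphisms, by the iterated Leibniz
    rule. *)
Lemma exp_ad_lie c x y : exp_ad c (lie x y) = lie (exp_ad c x) (exp_ad c y).
Proof.
have [N [x0 y0]] := common_nilpotency x y.
have leibniz k : iter k (lie u) (lie x y) =
    \sum_(i < k.+1) 'C(k, i)%:R *: lie (iter i (lie u) x) (iter (k - i) (lie u) y).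
  elim: k => [|k IH] /=; first by rewrite big_ord_recl big_ord0 addr0 scale1r.
  rewrite IH linear_sum /=.
  under eq_bigr do rewrite linearZ /= lie_leibniz scalerDr.
  rewrite big_split /= [in RHS]big_ord_recl /= bin0.
  under [in RHS]eq_bigr do rewrite binS natrD scalerDl.
  rewrite big_split /= addrA [RHS]addrC; congr (_ + _).
  rewrite big_ord_recl bin0 subn0 /=; congr (_ + _).
  rewrite [in RHS]big_ord_recr /= bin_small // scale0r addr0.
  by apply: eq_bigr => i _ /=; rewrite /bump /= add1n subSS -(subnSK (ltn_ord i)).
have lie0 i j : (N <= i)%N || (N <= j)%N ->
    lie (iter i (lie u) x) (iter j (lie u) y) = 0.
  by case/orP => h; [rewrite (iter_ad_eq0 x0) ?lie0l | rewrite (iter_ad_eq0 y0) ?linear0].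
rewrite (@exp_adE (N + N)); last first.
  by rewrite leibniz big1 // => i _; rewrite lie0 ?scaler0 //; lia.
rewrite !(@exp_adE N) // lie_suml.
under [RHS]eq_bigr do rewrite linear_sum /=.
rewrite -(@sum_antidiagonals _ (fun i j => lie ((c ^+ i / i`!%:R) *: iter i (lie u) x)
  ((c ^+ j / j`!%:R) *: iter j (lie u) y))) => [|i j ij]; last first.
  by rewrite lieZl linearZ /= lie0 ?scaler0.
apply: eq_bigr => k _; rewrite leibniz scaler_sumr; apply: eq_bigr => i _.
have ik : (i <= k)%N by rewrite -ltnS.
rewrite scalerA lieZl linearZ /= scalerA; congr (_ *: _).
rewrite -mulrA [_^-1 * _]mulrC bin_over_fact // -{1}(subnKC ik) exprD invfM.
by rewrite mulrACA.
Qed.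

Lemma exp_adK c : cancel (exp_ad c) (exp_ad (- c)).
Proof.
move=> x; have [N /eqP x0] := nilp x.
pose g i j := (((- c) ^+ i / i`!%:R) * (c ^+ j / j`!%:R)) *: iter (i + j) (lie u) x.
have -> : exp_ad (- c) (exp_ad c x) = \sum_(i < N) \sum_(j < N) g i j.
  rewrite (@exp_adE N c) // linear_sum exchange_big /=; apply: eq_bigr => j _.
  rewrite linearZ /= (@exp_adE N); last first.
    by rewrite -iterD (iter_ad_eq0 x0) ?leq_addr.
  rewrite scaler_sumr; apply: eq_bigr => i _.
  by rewrite /g scalerA -iterD [X in X *: _]mulrC.
rewrite -sum_antidiagonals => [|i j ij]; last first.
  by rewrite /g (iter_ad_eq0 x0) ?scaler0 //; lia.
have E k : \sum_(i < k.+1) g i (k - i)%N =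
   ((c + - c) ^+ k / k`!%:R) *: iter k (lie u) x.
  rewrite exprDn mulr_suml scaler_suml; apply: eq_bigr => i _.
  have ik : (i <= k)%N by rewrite -ltnS.
  rewrite /g subnKC //; congr (_ *: _).
  rewrite -[in RHS]mulr_natr -[RHS]mulrA bin_over_fact // invfM.
  by rewrite mulrACA [_ ^+ _ * c ^+ _]mulrC.
under eq_bigr do rewrite E subrr.
case: N x0 {g E} => [/= ->|N x0]; first by rewrite big_ord0.
rewrite addSn big_ord_recl expr0 fact0 divr1 scale1r big1 ?addr0 //= => i _.
by rewrite exprS !mul0r scale0r.
Qed.

(** The exponential of a locally nilpotent operator is a polynomial curve with
    initial point [x] and initial velocity [lie u x]. *)
Lemma scalar_exp_ad (f : {scalar L}) x : exists p : {poly K},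
  [/\ forall c, f (exp_ad c x) = p.[c], p`_0 = f x & p`_1 = f (lie u x)].
Proof.
have [N /eqP x0] := nilp x.
exists (\poly_(k < N.+2) (f (iter k (lie u) x) / k`!%:R)); split=> [c||].
- rewrite (@exp_adE N.+2) ?(iter_ad_eq0 x0) 1?ltnW // linear_sum horner_poly.
  by apply: eq_bigr => k _ /=; rewrite linearZ /= mulrC mulrAC mulrA.
- by rewrite coef_poly fact0 divr1.
- by rewrite coef_poly divr1.
Qed.

(** The automorphism [exp (- c ad u)] carries generating pairs to generating
    pairs. *)
Lemma generates_exp_ad c x y :
  generates (fun z => z = exp_ad c x \/ z = y) ->
  generates (fun z => z = x \/ z = exp_ad (- c) y).
Proof.
move=> gen z A [A0 AP Alie] Axy; rewrite -(exp_adK c z).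
apply: (gen _ (fun w => A (exp_ad (- c) w))).
  split=> [|a v w Av Aw|v w Av Aw]; first by rewrite linear0.
    by rewrite linearP; apply: AP.
  by rewrite exp_ad_lie; apply: Alie.
by move=> _ [->|->]; apply: Axy; [left; rewrite exp_adK | right].
Qed.

End Exponential.

(** * General position *)

(** It suffices to treat the elements on which finitely many forms [f i] are all
    nonzero, as soon as each [f i] can be made nonzero by a word of ad-nilpotent
    brackets.  The forms are treated one after the other, and the letters of the
    word of each form are replaced by exponentials from the innermost outwards:
    for generic [c], passing to [exp (c ad u) x] shortens the word by its last
    letter [u] and preserves the nonvanishing already achieved. *)
Lemma generic_reduction (I : eqType) (f : I -> {scalar L}) (s : seq I)
    (U : L -> Prop) :
  [pchar K] =i pred0 ->
  (forall u x, U u -> exists N, iter N (lie u) x == 0) ->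
  (forall i x, i \in s -> x != 0 ->
     exists2 w, (forall u, u \in w -> U u) & f i (ad_word w x) != 0) ->
  (forall x, x != 0 -> (forall i, i \in s -> f i x != 0) ->
     exists y, generates (fun z => z = x \/ z = y)) ->
  one_and_a_half_generated L.
Proof.
move=> char0 nilpU; elim: s => [_ goal x x0|i s IH words goal]; first exact: goal.
apply: IH => [j x sj|x x0 fx]; first by apply: words; rewrite inE sj orbT.
have [w] := words i x (mem_head _ _) x0.
elim/last_ind: w x x0 fx => [|w u IHw] x x0 fx wU fwx.
  by apply: goal => // j; rewrite inE => /predU1P[->|/fx].
have Uu : U u by apply: wU; rewrite mem_rcons mem_head.
have nilp z : exists N, iter N (lie u) z == 0 by exact: nilpU.
pose P c := forall j, j \in s -> f j (exp_ad nilp c x) != 0.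
have [c Pc fc] : exists2 c, P c & f i (ad_word w (exp_ad nilp c x)) != 0.
  have [p [pE _ p1]] := scalar_exp_ad nilp (f i \o ad_word w : {scalar L}) x.
  have [q qE] : exists q : I -> {poly K}, forall j, j \in s ->
      q j != 0 /\ forall c, f j (exp_ad nilp c x) = (q j).[c].
    elim: {IHw words goal P} s fx => [|k s IHs] fx; first by exists (fun=> 0).
    have [j sj|q qE] := IHs; first by apply: fx; rewrite inE sj orbT.
    have [r [rE r0 _]] := scalar_exp_ad nilp (f k) x.
    exists (fun j => if j == k then r else q j) => j; rewrite inE.
    case: eqP => [-> _|_ /qE //]; split=> //.
    by apply: contraTneq (fx k (mem_head _ _)) => r_0; rewrite -r0 r_0 coef0 eqxx.
  have [|c /= /andP[pc /allP qc]] :=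
    @exists_common_nonroot _ (p :: [seq q j | j <- s]) char0.
    rewrite /=; apply/andP; split.
      apply: contraNneq fwx => p_0; rewrite /ad_word foldr_rcons.
      by rewrite p_0 coef0 in p1; rewrite -[f i _]p1.
    by apply/allP => _ /mapP[j /qE[q0 _] ->].
  exists c; last by rewrite -pE in pc.
  by move=> j sj; have [_ ->] := qE j sj; apply: qc; apply: map_f.
have [|v vU|y gen] := IHw _ _ Pc _ fc.
- by apply: contraNneq fc => ->; rewrite !linear0.
- by apply: wU; rewrite mem_rcons inE vU orbT.
by exists (exp_ad nilp (- c) y); apply: generates_exp_ad.
Qed.

(** Applying [ad h - e i] kills the eigenvector [v i] and rescales [x0] by
    a nonzero factor, so the terms of the sum can be removed one by one. *)
Lemma lie_subalgebra_eigen (A : L -> Prop) h x (I : eqType) (s : seq I)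
    (v : I -> L) (e : I -> K) x0 e0 :
  lie_subalgebra A -> A h -> A x -> x = x0 + \sum_(i <- s) v i ->
  lie h x0 = e0 *: x0 -> (forall i, i \in s -> lie h (v i) = e i *: v i) ->
  (forall i, i \in s -> e i != e0) -> A x0.
Proof.
move=> [_ AP Alie] Ah; elim: s x x0 v => [|i s IH] x x0 v Ax xE h0 hv es.
  by rewrite xE big_nil addr0 in Ax.
have AZ (a : K) y : A y -> A (a *: y).
  have A0 : A 0 by rewrite -(lie_alternating x); apply: Alie.
  by move=> Ay; rewrite -[_ *: _]addr0; apply: AP.
have es' : e0 - e i != 0 by rewrite subr_eq0 eq_sym es ?mem_head.
rewrite -[x0]scale1r -(mulVf es') -scalerA; apply: AZ.
apply: (IH (- e i *: x + lie h x) _ (fun j => (e j - e i) *: v j)).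
- by apply: AP => //; apply: Alie.
- rewrite xE big_cons !linearD /= h0 hv ?mem_head // linear_sum /=.
  rewrite addrACA -scalerDl; congr (_ + _); first by rewrite addrC.
  rewrite addrACA -scalerDl addNr scale0r add0r linear_sum -big_split /=.
  rewrite big_seq [RHS]big_seq; apply: eq_bigr => j sj.
  by rewrite hv ?inE ?sj ?orbT // -scalerDl addrC.
- by rewrite linearZ /= h0 !scalerA mulrC.
- by move=> j sj; rewrite linearZ /= hv ?inE ?sj ?orbT // !scalerA mulrC.
- by move=> j sj; rewrite es // inE sj orbT.
Qed.

End LieAlgebras.

(** * Shears: the fields f d/dx_j with f independent of x_j *)

Section VectorFields.
Variables (K : fieldType) (n : nat).
Implicit Types (p q f g : {mpoly K[n]}) (m : 'X_{1..n}) (i j k : 'I_n)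
  (v w : Vec K n) (x u : VecC K n).

HB.instance Definition _ v :=
  GRing.isLinear.Build K (Vec K n) (Vec K n) _ (vbracket v) (vbracket_linearr v).

Lemma vfield_linear i : linear (@vfield K n i).
Proof.
by move=> a f g; apply/ffunP => k; rewrite !ffunE; case: ifP; rewrite // scaler0 addr0.
Qed.
HB.instance Definition _ i :=
  GRing.isLinear.Build K {mpoly K[n]} (Vec K n) _ (vfield i) (vfield_linear i).

Lemma vapply_vfield i f p : vapply (vfield i f) p = f * mderiv i p.
Proof.
rewrite /vapply (bigD1 i) //= big1 ?addr0 => [|k /negPf ki].
  by rewrite ffunE eqxx.
by rewrite ffunE ki mul0r.
Qed.

Lemma divergence_vfield i f : divergence (vfield i f) = mderiv i f.
Proof.
rewrite /divergence (bigD1 i) //= big1 ?addr0 => [|k /negPf ki].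
  by rewrite ffunE eqxx.
by rewrite ffunE ki mderiv0.
Qed.

Lemma mderiv_var i j : mderiv j 'X_i = ((i == j)%:R : K)%:MP.
Proof.
rewrite mderivX mnm1E; case: eqP => [->|_]; last by rewrite scale0r mpolyC0.
by rewrite scale1r -[X in (X - _)%MM]add0m addmK mpolyX0 mpolyC1.
Qed.

Lemma mderiv_exp_eq0 j f N : mderiv j f = 0 -> mderiv j (f ^+ N) = 0.
Proof.
move=> f0; elim: N => [|N IH]; first by rewrite expr0 -mpolyC1 mderivC.
by rewrite exprS mderivM f0 IH mul0r mulr0 addr0.
Qed.

Lemma iter_mderiv_eq0 i N p : (msize p <= N)%N -> iter N (mderiv i) p = 0.
Proof.
move=> pN; have {pN} : forall m, (N <= m i)%N -> p@_m = 0.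
  move=> m Nm; apply/memN_msupp_eq0/msize_mdeg_ge/(leq_trans pN)/(leq_trans Nm).
  by rewrite mdegE (bigD1 i) //= leq_addr.
elim: N p => [|N IH] p p0; first by apply/mpolyP => m; rewrite mcoeff0 p0.
rewrite iterSr IH // => m Nm; rewrite mcoeff_mderiv p0 ?mul0rn //.
by rewrite mnmDE mnm1E eqxx addn1.
Qed.

Lemma iter_mulX_mderiv j f p N : mderiv j f = 0 ->
  iter N (fun q => f * mderiv j q) p = f ^+ N * iter N (mderiv j) p.
Proof.
move=> f0; elim: N => [|N IH] /=; first by rewrite expr0 mul1r.
by rewrite IH mderivM mderiv_exp_eq0 // mul0r add0r mulrA -exprS.
Qed.

Definition is_shear x := exists j f, mderiv j f = 0 /\ val x = vfield j f.

Lemma shear_const_div j f : mderiv j f = 0 -> vfield j f \in @const_div K n.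
Proof. by move=> f0; apply/const_divP; exists 0; rewrite divergence_vfield f0 mpolyC0. Qed.

Definition shear j f (f0 : mderiv j f = 0) : VecC K n := MkVecC (shear_const_div f0).

Lemma shearP j f (f0 : mderiv j f = 0) : is_shear (shear f0).
Proof. by exists j, f. Qed.

(** On the components other than the [j]-th, [ad (f d/dx_j)] acts as [f d/dx_j],
    which lowers the degree in [x_j].  Once these components have vanished, it
    acts in the same way on the [j]-th one. *)
Lemma shear_ad_nilpotent u x : is_shear u -> exists N, iter N (lie u) x == 0.
Proof.
move=> [j [f [f0 uE]]].
have valE N : val (iter N (lie u) x) = iter N (vbracket (vfield j f)) (val x).
  by elim: N => //= N <-; rewrite -uE.
have off v k N : k != j ->
    iter N (vbracket (vfield j f)) v k = f ^+ N * iter N (mderiv j) (v k).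
  move=> /negPf kj; rewrite -iter_mulX_mderiv //; elim: N => //= N IH.
  by rewrite !ffunE vapply_vfield IH kj linear0 subr0.
have on N g : iter N (vbracket (vfield j f)) (vfield j g) =
    vfield j (f ^+ N * iter N (mderiv j) g).
  rewrite -iter_mulX_mderiv //; elim: N => //= N ->.
  by rewrite vbracket_vfield f0 mulr0 linear0 subr0.
pose N := \max_k msize (val x k).
set v := iter N (vbracket (vfield j f)) (val x) in valE.
have vE : v = vfield j (v j).
  apply/ffunP => k; rewrite ffunE; case: eqP => [->//|/eqP kj].
  by rewrite off // iter_mderiv_eq0 ?mulr0 // (leq_bigmax k).
exists (msize (v j) + N)%N; apply/eqP/val_inj.
by rewrite valE iterD -/v vE on iter_mderiv_eq0 ?mulr0 ?linear0 // -vE.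
Qed.

Definition vcoef (t : 'I_n * 'X_{1..n}) x : K := (val x t.1)@_(t.2).

Lemma vcoef_scalar t : scalar (vcoef t).
Proof. by move=> a x y; rewrite /vcoef !ffunE mcoeffD mcoeffZ. Qed.
HB.instance Definition _ t :=
  GRing.isLinear.Build K (VecC K n) K _ (vcoef t) (vcoef_scalar t).

Lemma mpoly_const p : [pchar K] =i pred0 -> (forall i, mderiv i p = 0) -> p = (p@_0%MM)%:MP.
Proof.
move=> /pcharf0P char0 dp; apply/mpolyP => m; rewrite mcoeffC.
case: (eqVneq m 0%MM) => [->|m0]; first by rewrite mulr1.
rewrite mulr0; have [i mi] : exists i, m i != 0%N.
  apply/existsP; rewrite -negb_forall; apply: contra m0 => /forallP m0.
  by apply/eqP/mnmP => i; rewrite mnm0E; apply/eqP.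
have Ui : (U_(i) <= m)%MM.
  by apply/mnm_lepP => k; rewrite mnm1E; case: eqP => // <-; rewrite lt0n.
have := congr1 (mcoeff (m - U_(i))) (dp i); rewrite mcoeff_mderiv submK // mcoeff0.
by move/eqP; rewrite -mulr_natr mulf_eq0 char0 orbF => /eqP.
Qed.

(** The word that detects the coefficient of [x_a^d d/dx_b] consists of partial
    derivatives leading to a nonzero constant field, at most one field
    [x_i d/dx_a] that makes the [a]-component nonzero, and finally
    [x_a^(d+1) d/dx_b]. *)
Lemma shear_word_vcoef x a b (d : nat) : [pchar K] =i pred0 -> x != 0 -> a != b ->
  exists2 s, (forall u, u \in s -> is_shear u) &
             vcoef (b, (U_(a) *+ d)%MM) (ad_word s x) != 0.
Proof.
move=> char0 x0 ab.
pose goal y := exists2 s, (forall u, u \in s -> is_shear u) &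
  vcoef (b, (U_(a) *+ d)%MM) (ad_word s y) != 0.
rewrite -/(goal x).
have step u y : is_shear u -> goal (lie u y) -> goal y.
  move=> shu [s ss sy]; exists (rcons s u); last by rewrite /ad_word foldr_rcons.
  by move=> t; rewrite mem_rcons inE => /predU1P[->|/ss].
have neq_vec (v : Vec K n) : v != 0 -> exists i, v i != 0.
  move=> v0; apply/existsP; rewrite -negb_forall; apply: contra v0 => /forallP v0.
  by apply/eqP/ffunP => i; rewrite (eqP (v0 i)) ffunE.
have Xd c (e : nat) : mderiv c ('X_a ^+ e.+1) =
    ((e.+1)%:R * (a == c)%:R) *: 'X_a ^+ e :> {mpoly K[n]}.
  rewrite mpolyXn mderivX mulmnE mnm1E; case: eqP => [<-|_]; last by rewrite mulr0 !scale0r.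
  by rewrite mul1n mulr1 mpolyXn mulmS addmC addmK.
(* Bracketing a constant field [y] with [x_a^(d+1) d/dx_b] applies [y] to
   [x_a^(d+1)], up to sign. *)
have base (y : VecC K n) : (forall i j, mderiv i (val y j) = 0) -> (val y a) != 0 -> goal y.
  move=> dy ya; have f0 : mderiv b ('X_a ^+ d.+1 : {mpoly K[n]}) = 0.
    by rewrite Xd (negPf ab) mulr0 scale0r.
  apply: (step (shear f0)); first exact: shearP.
  exists [::] => //; rewrite /vcoef /= !ffunE eqxx vapply_vfield dy mulr0 sub0r.
  rewrite /vapply (bigD1 a) //= big1 ?addr0 => [|i ia]; last first.
    by rewrite Xd eq_sym (negPf ia) mulr0 scale0r mulr0.
  rewrite Xd eqxx mulr1 -scalerAr mcoeffN mcoeffZ [val y a](mpoly_const char0) //.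
  rewrite mcoeffCM mpolyXn mcoeffX eqxx mulr1 oppr_eq0 mulf_neq0 //.
    by move/pcharf0P: char0 => ->.
  by apply: contra ya => /eqP c0; rewrite [val y a](mpoly_const char0) // c0 mpolyC0.
have const (y : VecC K n) : (forall i j, mderiv i (val y j) = 0) -> y != 0 -> goal y.
  move=> dy y0; have [ya|] := eqVneq (val y a) 0; last exact: base.
  have [|i yi] := neq_vec (val y); first by rewrite (inj_eq val_inj _ (0 : VecC K n)).
  have ia : i != a by apply: contraNneq yi => ->; rewrite ya.
  have f0 : mderiv a ('X_i : {mpoly K[n]}) = 0.
    by rewrite mderiv_var (negPf ia) mpolyC0.
  have E k : val (lie (shear f0) y) k = - (if k == a then val y i else 0).
    rewrite /= !ffunE vapply_vfield dy mulr0 sub0r; case: eqP => _; last by rewrite linear0.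
    rewrite /vapply (bigD1 i) //= big1 ?addr0 => [|k' ki]; last first.
      by rewrite mderiv_var eq_sym (negPf ki) mpolyC0 mulr0.
    by rewrite mderiv_var eqxx mpolyC1 mulr1.
  apply: (step (shear f0)); first exact: shearP.
  apply: base => [k l|]; last by rewrite E eqxx oppr_eq0.
  by rewrite E linearN /=; case: ifP => _; rewrite ?dy ?linear0 ?oppr0.
(* [N] bounds the degrees; a nonconstant field has a nonzero partial derivative
   of smaller degree. *)
have bounded : forall N (y : VecC K n), (forall j m, (N <= mdeg m)%N -> (val y j)@_m = 0) ->
    y != 0 -> goal y.
  elim=> [|N IH] y yN y0.
    case/eqP: y0; apply/val_inj/ffunP => j; apply/mpolyP => m.
    by rewrite yN // ffunE mcoeff0.
  have [/existsP[i /existsP[j dij]]|] := boolP [exists i, exists j, mderiv i (val y j) != 0].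
    have f0 : mderiv i (1 : {mpoly K[n]}) = 0 by rewrite -mpolyC1 mderivC.
    have E k : val (lie (shear f0) y) k = mderiv i (val y k).
      rewrite /= !ffunE vapply_vfield mul1r.
      by case: ifP => _; [rewrite -[1]mpolyC1 vapplyC | rewrite linear0]; rewrite subr0.
    apply: (step (shear f0)); first exact: shearP.
    apply: IH => [k m Nm|].
      by rewrite E mcoeff_mderiv yN ?mul0rn // mdegD mdeg1 addn1.
    by apply: contraNneq dij => d0; rewrite -E d0 ffunE.
  rewrite negb_exists => /forallP dy; apply: const => // i j.
  by have := dy i; rewrite negb_exists => /forallP/(_ j); rewrite negbK => /eqP.
apply: (bounded (\max_k msize (val x k))) x0 => j m /(leq_trans (leq_bigmax j)) jm.
exact/memN_msupp_eq0/msize_mdeg_ge.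
Qed.

Lemma mulX_mderivX i m : 'X_i * mderiv i 'X_[m] = (m i)%:R *: 'X_[m] :> {mpoly K[n]}.
Proof.
rewrite mderivX -scalerAr -mpolyXD; case: (posnP (m i)) => [->|mi].
  by rewrite !scale0r.
rewrite addmC submK //; apply/mnm_lepP => k.
by rewrite mnm1E; case: eqP => // <-.
Qed.

(** * Diagonal fields and weights *)

Definition diag_field (t : K) : Vec K n := [ffun i : 'I_n => t ^+ i *: 'X_i].

Lemma divergence_diag_field t : divergence (diag_field t) = (\sum_(i < n) t ^+ i)%:MP.
Proof.
rewrite /divergence rmorph_sum; apply: eq_bigr => i _ /=.
by rewrite ffunE linearZ /= mderiv_var eqxx -mul_mpolyC -mpolyCM mulr1.
Qed.

Lemma diag_field_const_div t : diag_field t \in @const_div K n.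
Proof. by apply/const_divP; eexists; exact: divergence_diag_field. Qed.

(** The weight of [x^m d/dx_j] for the torus, [m - e_j], encoded as a polynomial:
    its value at [t] is the eigenvalue of [ad (diag_field t)]. *)
Definition weight (s : 'I_n * 'X_{1..n}) : {poly K} :=
  \sum_(i < n) ((s.2 i)%:R - (i == s.1)%:R) *: 'X^i.

Lemma coef_weight s i : (weight s)`_i = (s.2 i)%:R - (i == s.1)%:R.
Proof.
rewrite coef_sum (bigD1 i) //= big1 => [|k /negPf ki].
  by rewrite addr0 coefZ coefXn eqxx mulr1.
have ik : (i == k :> nat) = false by rewrite eq_sym; exact: ki.
by rewrite coefZ coefXn ik mulr0.
Qed.

Lemma diag_field_eigen t s : vbracket (diag_field t) (vfield s.1 'X_[s.2]) =
  (weight s).[t] *: vfield s.1 'X_[s.2].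
Proof.
case: s => j m /=; apply/ffunP => k; rewrite !ffunE vapply_vfield.
case: eqP => [->|/eqP kj]; last first.
  by rewrite linear0 sub0r linearZ /= mderiv_var (negPf kj) mpolyC0 scaler0 mulr0 scaler0 oppr0.
rewrite linearZ /= mderiv_var eqxx mpolyC1 -scalerAr mulr1 /vapply.
under eq_bigr do rewrite ffunE -scalerAl mulX_mderivX scalerA.
rewrite -scaler_suml -scalerBl; congr (_ *: _).
rewrite horner_sum (bigD1 j) //= [in RHS](bigD1 j) //= eqxx !(hornerE, hornerXn).
rewrite mulrBl mul1r addrAC [_ * t ^+ j]mulrC; congr (_ - _ + _).
by apply: eq_bigr => i /negPf ij; rewrite !(hornerE, hornerXn) ij subr0 mulrC.
Qed.

(** When [m0] does not involve [x_j0], the weight of [x^m0 d/dx_j0] is [-1] at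
    [j0].  Only a field in direction [d/dx_j0] can have a negative entry there,
    and then the weight determines the monomial. *)
Lemma weight_inj (s0 s : 'I_n * 'X_{1..n}) : [pchar K] =i pred0 -> s0.2 s0.1 = 0%N ->
  weight s = weight s0 -> s = s0.
Proof.
move=> char0; case: s0 s => j0 m0 [j m] /= m0j0 eq_w.
have eq_i i : (m i + (i == j0))%N = (m0 i + (i == j))%N.
  have /eqP := congr1 (fun p : {poly K} => p`_i) eq_w; rewrite !coef_weight /=.
  by rewrite subr_eq addrAC eq_sym subr_eq -!natrD => /eqP/(natr_inj char0).
have jj0 : j = j0.
  by have := eq_i j0; rewrite m0j0 eqxx addn1 add0n; case: eqP => // ->.
subst j0; congr (_, _); apply/mnmP => i; exact: addIn (eq_i i).
Qed.

Lemma vecC_sum_monomials x d : (forall j, (msize (val x j) <= d)%N) ->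
  val x = \sum_(s : 'I_n * 'X_{1..n < d})
    vcoef (s.1, val s.2) x *: vfield s.1 'X_[s.2].
Proof.
move=> xd; rewrite [LHS]vec_sumE.
rewrite -(pair_bigA _ (fun j (m : 'X_{1..n < d}) =>
  vcoef (j, val m) x *: vfield j 'X_[m])) /=.
apply: eq_bigr => j _; rewrite {1}(mpolywE (xd j)) linear_sum.
by apply: eq_bigr => m _; rewrite linearZ.
Qed.

(** Any other monomial field in the expansion of [x] has a weight different from
    that of [s0], hence a different eigenvalue under [ad (diag_field t)]. *)
Lemma monomial_in_subalgebra A x t d (s0 : 'I_n * 'X_{1..n}) : [pchar K] =i pred0 ->
  lie_subalgebra A -> A (diag_field t) -> A (val x) ->
  (forall j, (msize (val x j) <= d)%N) ->
  (forall s s' : 'I_n * 'X_{1..n < d},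
     weight (s.1, val s.2) != weight (s'.1, val s'.2) ->
     (weight (s.1, val s.2)).[t] != (weight (s'.1, val s'.2)).[t]) ->
  vcoef s0 x != 0 -> s0.2 s0.1 = 0%N -> A (vfield s0.1 'X_[s0.2]).
Proof.
move=> char0 subA At Ax xd gen x0 s00.
have [_ AP _] := subA.
have s0d : (mdeg s0.2 < d)%N.
  by apply: leq_trans (xd s0.1); apply: msize_mdeg_lt; rewrite mcoeff_msupp.
pose s1 : 'I_n * 'X_{1..n < d} := (s0.1, BMultinom s0d).
have s1E : (s1.1, val s1.2) = s0 by rewrite [RHS]surjective_pairing.
suff : A (vcoef s0 x *: vfield s0.1 'X_[s0.2]).
  move=> /(AP (vcoef s0 x)^-1 _ 0); rewrite scalerA mulVf // scale1r addr0; apply.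
  by case: subA.
pose F (s : 'I_n * 'X_{1..n < d}) := vcoef (s.1, val s.2) x *: vfield s.1 'X_[s.2].
apply: (@lie_subalgebra_eigen K (Vec K n) A (diag_field t) (val x) _
  [seq s <- index_enum ('I_n * 'X_{1..n < d})%type | s != s1] F
  (fun s => (weight (s.1, val s.2)).[t]) _ (weight s0).[t]) => //.
- by rewrite (vecC_sum_monomials xd) (bigD1 s1) //= s1E big_filter.
- by rewrite linearZ /= [lie _ _]diag_field_eigen !scalerA mulrC.
- move=> s _; rewrite linearZ /= [lie _ _](diag_field_eigen t (s.1, val s.2)).
  by rewrite /F !scalerA mulrC.
- move=> s; rewrite mem_filter => /andP[ss1 _]; rewrite -s1E; apply: gen.
  apply: contraNneq ss1; rewrite s1E => /(weight_inj char0 s00).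
  rewrite -s1E => -[e1 e2]; apply/eqP; case: s e1 e2 => a b /= -> e.
  by congr (_, _); apply: val_inj.
Qed.

(** * Generating the divergence-free fields *)

Section Generation.
Variable A : Vec K n -> Prop.
Hypothesis char0 : [pchar K] =i pred0.
Hypothesis subA : lie_subalgebra A.

Lemma subalg0 : A 0. Proof. by case: subA. Qed.
Lemma subalgD v w : A v -> A w -> A (v + w).
Proof. by case: subA => _ + _ => /(_ 1 v w); rewrite scale1r. Qed.
Lemma subalgZ a v : A v -> A (a *: v).
Proof. by case: subA => A0 + _ => /(_ a v 0); rewrite addr0 => + Av; apply. Qed.
Lemma subalg_lie v w : A v -> A w -> A (vbracket v w).
Proof. by case: subA => _ _; apply. Qed.

Hypothesis Ad : forall j, A (vfield j 1).
Hypothesis AX2 : forall i j, i != j -> A (vfield j 'X_[U_(i) *+ 2]).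

Lemma mderiv_indep j m : m j = 0%N -> mderiv j 'X_[m] = 0 :> {mpoly K[n]}.
Proof. by move=> mj; rewrite mderivX mj scale0r. Qed.

Lemma linear_shear_in i j : i != j -> A (vfield j 'X_i).
Proof.
move=> ij; suff -> : vfield j 'X_i =
    (2 : K)^-1 *: vbracket (vfield i 1) (vfield j ('X_[U_(i) *+ 2])).
  by apply/subalgZ/subalg_lie; [apply: Ad | apply: AX2].
rewrite vbracket_vfield mul1r -mpolyC1 mderivC mulr0 linear0 subr0 -linearZ /=.
rewrite mderivX mulmnE mnm1E eqxx mul1n scalerA.
rewrite mulVf ?(natr_neq0 char0) // scale1r.
by rewrite mulmS mulm1n addmK.
Qed.

(** For a monomial [f] the Euler relation [x_i df/dx_i = m_i f] makes the right
    side the multiple [2 m_i + 4] of [x_i f d/dx_j], so the triple bracket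
    multiplies the coefficient by [x_i] without ever vanishing.  For two
    variables and [f = x^k] this is a chain of Poisson brackets, from [x^(k+1)]
    to [x^k y^2], [x^(k+1) y] and [x^(k+2)] up to constants. *)
Lemma raise_shear i j f : mderiv j f = 0 -> i != j ->
  vbracket (vfield j 'X_i) (vbracket (vfield j 'X_i)
    (vbracket (vfield i 'X_[U_(j) *+ 2]) (vfield j f))) =
  vfield j ((2 : K) *: ('X_i * ('X_i * mderiv i f)) + (4 : K) *: ('X_i * f)).
Proof.
move=> f0 ij; have ji : j != i by rewrite eq_sym.
have g0 : mderiv j (mderiv i f) = 0 by rewrite mderiv_comm f0 linear0.
rewrite -mpolyXn expr2 vbracket_vfield linearB /= !vbracket_vfield !linearB /= !vbracket_vfield.
apply/ffunP => k; rewrite !ffunE.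
have d1 : mderiv j (1 : {mpoly K[n]}) = 0 by rewrite -mpolyC1 mderivC.
pose dE := (mderivM, mderivB, mderivD, mderiv_var, mderiv0, d1, f0, g0,
  eqxx, negPf ij, negPf ji, mpolyC0, mpolyC1).
have [->|_] := eqVneq k j; first rewrite (negPf ji).
  by rewrite !dE -!mul_mpolyC !mpolyC_nat; ring.
by case: eqP => [_|_]; rewrite ?dE; ring.
Qed.

Lemma shear_monomial_in j m : m j = 0%N -> A (vfield j 'X_[m]).
Proof.
move eq_d: (mdeg m) => d; elim: d m eq_d => [|d IH] m eq_d mj.
  by move/eqP: eq_d; rewrite mdeg_eq0 => /eqP ->; rewrite mpolyX0.
have [i mi] : exists i, m i != 0%N.
  apply/existsP; rewrite -negb_forall; apply/negP => /forallP m0.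
  by move: eq_d; rewrite mdegE big1 // => i _; apply/eqP.
have ij : i != j by apply: contraNneq mi => ->; rewrite mj.
have Ui : (U_(i) <= m)%MM.
  by apply/mnm_lepP => k; rewrite mnm1E; case: eqP => // <-; rewrite lt0n.
pose m' := (m - U_(i))%MM; have mE : m = (m' + U_(i))%MM by rewrite submK.
have m'j : m' j = 0%N by rewrite mnmBE mj.
have Am' : A (vfield j 'X_[m']).
  by apply: IH => //; move: eq_d; rewrite mE mdegD mdeg1 addn1 => -[].
have Xi := linear_shear_in ij.
have Xj : A (vfield i 'X_[U_(j) *+ 2]) by apply: AX2; rewrite eq_sym.
have := subalg_lie Xi (subalg_lie Xi (subalg_lie Xj Am')).
rewrite raise_shear ?(mderiv_indep m'j) // mulX_mderivX -scalerAr -mpolyXD addmC -mE.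
rewrite scalerA -scalerDl -natrM -natrD linearZ /= => /(subalgZ (2 * m' i + 4)%:R^-1).
by rewrite scalerA mulVf ?scale1r // addnS (natr_neq0 char0).
Qed.

(** For [x^m = r x_i^a x_j^b] with [r] free of [x_i] and [x_j], the bracket of
    the shears [r x_j^(b+1) d/dx_i] and [x_i^a d/dx_j] has [i]-component
    [-(b+1) x^m]; being a bracket of divergence-free fields it is
    divergence-free. *)
Lemma divergence_free_completion i j f : i != j ->
  exists g, A (vfield i f + vfield j g) /\ mderiv i f + mderiv j g = 0.
Proof.
move=> ij; have ji : j != i by rewrite eq_sym.
elim/mpolyind: f => [|a m f _ _ [g [Ag div0]]].
  by exists 0; rewrite !linear0 !addr0; split=> //; apply: subalg0.
(* [x^m'] is [r x_j^(b+1)] and [h] is [x_i^a]. *)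
pose m' := (m - U_(i) *+ m i + U_(j))%MM.
have m'i : m' i = 0%N by rewrite mnmDE mnmBE mulmnE !mnm1E eqxx mul1n subnn (negPf ji).
have m'j : m' j = (m j).+1 by rewrite mnmDE mnmBE mulmnE !mnm1E eqxx (negPf ij) subn0 addn1.
pose h := 'X_[U_(i) *+ m i] : {mpoly K[n]}.
have h0 : mderiv j h = 0 by apply: mderiv_indep; rewrite mulmnE mnm1E (negPf ij).
have hE : h * mderiv j 'X_[m'] = ((m j).+1)%:R *: 'X_[m].
  rewrite mderivX m'j addmK -scalerAr -mpolyXD addmC submK //.
  by apply/mnm_lepP => k; rewrite mulmnE mnm1E; case: eqP => [<-|]; rewrite ?mul1n.
pose c : K := - (a / ((m j).+1)%:R).
have Abr : A (c *: vbracket (vfield i 'X_[m']) (vfield j h)).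
  apply/subalgZ/subalg_lie; apply: shear_monomial_in => //.
  by rewrite mulmnE mnm1E (negPf ij).
exists (c *: ('X_[m'] * mderiv i h) + g).
have E : vfield i (a *: 'X_[m]) + vfield j (c *: ('X_[m'] * mderiv i h)) =
    c *: vbracket (vfield i 'X_[m']) (vfield j h).
  rewrite vbracket_vfield hE; apply/ffunP => k; rewrite !ffunE.
  have [->|_] := eqVneq k i.
    rewrite (negPf ij) addr0 sub0r scalerN scalerA -scaleNr -mulNr opprK.
    by rewrite divfK ?(natr_neq0 char0).
  by case: ifP => _; rewrite add0r ?subr0 ?scaler0 // subr0 scaler0.
have div0' : mderiv i (a *: 'X_[m]) + mderiv j (c *: ('X_[m'] * mderiv i h)) = 0.
  have /= := congr1 (@divergence K n) E.
  rewrite linearD /= !divergence_vfield => ->; rewrite linearZ /= divergence_bracket.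
  by rewrite !divergence_vfield h0 mderiv_indep // 2!linear0 subrr scaler0.
rewrite !linearD /= addrACA E [X in _ /\ X = _]addrACA div0' add0r.
by split=> //; apply: subalgD.
Qed.

(** All components but the [j]-th are removed by [divergence_free_completion];
    what remains is [h d/dx_j] of divergence [dh/dx_j = 0], a sum of monomial
    shears. *)
Lemma divergence_free_in v i j : i != j -> divergence v = 0 -> A v.
Proof.
move=> ij div0; rewrite (vec_sumE v).
have [g Ag] : exists g, A (\sum_(k < n | k != j) vfield k (v k) + vfield j g) /\
    \sum_(k < n | k != j) mderiv k (v k) + mderiv j g = 0.
  elim: (index_enum _) => [|k s [g [Ag gdiv]]].
    by exists 0; rewrite !big_nil !linear0 !addr0; split=> //; apply: subalg0.
  rewrite !big_cons; case: ifP => kj; last by exists g.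
  have [h [Ah hdiv]] := divergence_free_completion (v k) kj.
  exists (h + g); rewrite !linearD /= addrACA [X in _ /\ X = _]addrACA hdiv gdiv addr0.
  by split=> //; apply: subalgD.
case: Ag => Ag gdiv.
rewrite (bigD1 j) //=.
have -> : vfield j (v j) + \sum_(k < n | k != j) vfield k (v k) =
    (\sum_(k < n | k != j) vfield k (v k) + vfield j g) + vfield j (v j - g).
  by rewrite linearB /= -addrA [X in _ = _ + X]addrC subrK addrC.
apply: subalgD => //.
have f0 : mderiv j (v j - g) = 0.
  move: div0; rewrite /divergence (bigD1 j) //= linearB /= => /eqP.
  rewrite addr_eq0 => /eqP ->; move/eqP: gdiv; rewrite addrC addr_eq0 => /eqP ->.
  by rewrite subrr.
have indep m : m \in msupp (v j - g) -> m j = 0%N.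
  move=> mS; apply/eqP; rewrite -leqn0 leqNgt; apply: contraL mS => mj.
  have Uj : (U_(j) <= m)%MM by apply/mnm_lepP => k; rewrite mnm1E; case: eqP => // <-.
  have := congr1 (mcoeff (m - U_(j))) f0; rewrite mcoeff_mderiv submK // mcoeff0.
  move/eqP; rewrite -mulr_natr mulf_eq0 (negPf (natr_neq0 char0 (ltn0Sn _))) orbF.
  by rewrite mcoeff_eq0.
rewrite [v j - g]mpolyE linear_sum /= big_seq.
apply: (big_ind A subalg0 subalgD) => m /indep mj; rewrite linearZ /=.
exact/subalgZ/shear_monomial_in.
Qed.

End Generation.
End VectorFields.

(** * Generation by a generic diagonal field *)

Theorem corollary1 (K : fieldType) (n : nat)
    (charK : [pchar K]%R =i pred0) (hn : (2 <= n)%N) :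
  one_and_a_half_generated (VecC K n).
Proof.
(* The indices of [d/dx_b] and [x_a^2 d/dx_b] for [a != b]: finitely many
   generators, each determined by its weight. *)
pose S := [seq (t.1.1, (U_(t.1.2) *+ t.2)%MM) |
  t <- [seq (p, d) | p <- [seq p <- enum {: 'I_n * 'I_n} | p.2 != p.1], d <- [:: 0; 2]]] :
  seq ('I_n * 'X_{1..n}).
have SP s : s \in S -> exists b a d, a != b /\ s = (b, (U_(a) *+ d)%MM).
  case/mapP => -[p d] /allpairsP[[q e] [/=]]; rewrite mem_filter => /andP[qq _] _ [-> _] ->.
  by exists q.1, q.2, d.
have inS b a d : a != b -> d \in [:: 0; 2] -> (b, (U_(a) *+ d)%MM) \in S.
  move=> ab dd; apply/mapP; exists ((b, a), d) => //.
  by apply/allpairsP; exists ((b, a), d); rewrite mem_filter mem_enum ab.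
apply: (generic_reduction (s := S) (U := @is_shear K n)
  (f := fun s : 'I_n * 'X_{1..n} => vcoef s : {scalar VecC K n})) => //.
- by move=> u x /(shear_ad_nilpotent x).
- by move=> s x /SP[b [a [d [ab ->]]]] x0; exact: shear_word_vcoef.
move=> x x0 xS; pose d := \max_j msize (val x j).
have xd j : (msize (val x j) <= d)%N by apply: (leq_bigmax j).
pose i0 : 'I_n := Ordinal (ltnW hn); pose i1 : 'I_n := Ordinal hn.
pose T := ('I_n * 'X_{1..n < d})%type.
pose W (s : T) := weight K (s.1, val s.2).
pose trp : {poly K} := \sum_(i < n) 'X^i.
(* Besides separating the weights, [t] must give [diag_field n t] a nonzero
   divergence. *)
have [|t] := @exists_common_nonroot K (trp ::
    [seq W r.1 - W r.2 | r <- [seq r <- enum {: T * T} | W r.1 != W r.2]]) charK.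
  rewrite /= all_map; apply/andP; split.
    apply/eqP => /(congr1 (fun p : {poly K} => p`_i0)).
    rewrite coef_sum (bigD1 i0) //= coefXn big1 => [|i /negPf ii0].
      by rewrite addr0 coef0 => /eqP; rewrite oner_eq0.
    by rewrite coefXn eq_sym -[_ == _]/(i == i0) ii0.
  by apply/allP => r; rewrite mem_filter /= subr_eq0 => /andP[].
rewrite /= all_map => /andP[tr0 /allP gen].
exists (MkVecC (diag_field_const_div n t)) => y A subA Axt.
(* The subalgebra is moved to [Vec K n], where monomial fields are terms. *)
pose A' (v : Vec K n) := exists2 w : VecC K n, val w = v & A w.
suff [w /val_inj <- //] : A' (val y).
have subA' : lie_subalgebra A'.
  case: subA => A0 AP Alie; split.
  - by exists 0.
  - by move=> a _ _ [u <- Au] [w <- Aw]; exists (a *: u + w) => //; apply: AP.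
  - by move=> _ _ [u <- Au] [w <- Aw]; exists (lie u w) => //; apply: Alie.
have Ax : A' (val x) by exists x => //; apply: Axt; left.
have At : A' (diag_field n t).
  by exists (MkVecC (diag_field_const_div n t)) => //; apply: Axt; right.
have mon s : s \in S -> s.2 s.1 = 0%N -> A' (vfield s.1 'X_[s.2]).
  move=> sS s0; apply: (monomial_in_subalgebra charK subA' At Ax xd) => //; last exact: xS.
  move=> r r' rr'; rewrite -subr_eq0 -hornerN -hornerD.
  by apply: (gen (r, r')); rewrite mem_filter mem_enum /= rr'.
have [v [c [divv ->]]] : exists v c, divergence v = 0 /\ val y = c *: diag_field n t + v.
  have /const_divP[b yb] := valP y.
  pose c := b / (\sum_(i < n) t ^+ i).
  exists (val y - c *: diag_field n t), c; split; last by rewrite addrC subrK.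
  rewrite linearB linearZ /= yb divergence_diag_field -mul_mpolyC -mpolyCM divfK ?subrr //.
  by move: tr0; rewrite horner_sum; under eq_bigr do rewrite hornerXn.
have Av : A' v.
  apply: (divergence_free_in charK subA' _ _ (i := i0) (j := i1)) => // [j|i j ij].
    have [a aj] : exists a : 'I_n, a != j.
      by case: (eqVneq i0 j) => [<-|]; [exists i1 | exists i0].
    have := mon (j, (U_(a) *+ 0)%MM); rewrite /= mulm0n mpolyX0; apply; last by rewrite mnm0E.
    exact: (inS j a 0%N).
  apply: (mon (j, (U_(i) *+ 2)%MM)); first exact: inS.
  by rewrite /= mulmnE mnm1E (negPf ij).
by case: subA' => _ AP _; apply: AP.
Qed.
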